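(* Let $\xi\in\mathbb{C}$, $\eta\in\mathbb{C}$, and let $(\xi,\eta)$ denote the corresponding point of $TS^2$ in the holomorphic coordinates described in the context. The map $\Phi:TS^2\to\mathcal{L}$ takes $(\xi,\eta)$ to the oriented line in $\mathbb{R}^3=\mathbb{C}\oplus\mathbb{R}$ given by $$z=\frac{2(\eta-\overline{\eta}\xi^2)+2\xi(1+\xi\overline{\xi})r}{(1+\xi\overline{\xi})^2},\qquad t=\frac{-2(\eta\overline{\xi}+\overline{\eta}\xi)+(1-\xi^2\overline{\xi}^2)r}{(1+\xi\overline{\xi})^2},$$ where $z=x^1+ix^2$, $t=x^3$, $(x^1,x^2,x^3)$ are Euclidean coordinates on $\mathbb{R}^3$, and $r\in\mathbb{R}$ is an affine parameter along the line (increasing in the direction of its orientation) such that $r=0$ is the point on the line that lies closest to the origin.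
   Context: $\mathcal{L}$ is the set of oriented affine lines in Euclidean $\mathbb{R}^3$. Write $\mathbb{R}^3=\mathbb{C}\oplus\mathbb{R}$ with coordinates $(z,t)$, $z=x^1+ix^2$, $t=x^3$, where $(x^1,x^2,x^3)$ are the Euclidean coordinates. $S^2\subset\mathbb{R}^3$ is the unit sphere centred at the origin. The map $\Phi:TS^2\to\mathcal{L}$ is the bijection given by parallel translation: for $p\in S^2$ and $v\in T_pS^2$, with $v$ regarded as a vector in $\mathbb{R}^3$ orthogonal to $p$ and translated to the origin, $\Phi(p,v)$ is the oriented line with oriented unit direction $p$ passing through the point $v$, i.e. $\{v+rp : r\in\mathbb{R}\}$ oriented by increasing $r$. Coordinates on $TS^2$: $\xi\in\mathbb{C}$ is the coordinate on $S^2$ minus the south pole $(0,0,-1)$ obtained by stereographic projection from the south pole onto the plane through the equator, so that $\xi$ corresponds to the point of $S^2$ with $z=\frac{2\xi}{1+\xi\overline{\xi}}$, $t=\frac{1-\xi\overline{\xi}}{1+\xi\overline{\xi}}$. The pair $(\xi,\eta)\in\mathbb{C}^2$ is identified with the real tangent vector $\eta\frac{\partial}{\partial\xi}+\overline{\eta}\frac{\partial}{\partial\overline{\xi}}\in T_\xi S^2$. Here, writing $\xi=u+iv$ with $u,v$ real, $\frac{\partial}{\partial\xi}=\frac12\left(\frac{\partial}{\partial u}-i\frac{\partial}{\partial v}\right)$ and $\frac{\partial}{\partial\overline\xi}=\frac12\left(\frac{\partial}{\partial u}+i\frac{\partial}{\partial v}\right)$, so this vector is $\mathrm{Re}(\eta)\frac{\partial}{\partial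 u}+\mathrm{Im}(\eta)\frac{\partial}{\partial v}$. *)

(* Defs.v *)
From Stdlib Require Import Reals Lra.
From Coquelicot Require Import Coquelicot.
Open Scope R_scope.

(** Euclidean space as [C (+) R]: a point is [(z, t)] with [z = x1 + i x2] and
    [t = x3].  The norm of the product structure is the Euclidean one, see
    [norm_R3] below. *)
Definition R3 : NormedModule R_AbsRing :=
  prod_NormedModule R_AbsRing C_R_NormedModule R_NormedModule.

Definition mkR3 (z : C) (t : R) : R3 := (z, t).
Definition zc (x : R3) : C := fst x.
Definition tc (x : R3) : R := snd x.

Definition dot (x y : R3) : R :=
  Re (zc x) * Re (zc y) + Im (zc x) * Im (zc y) + tc x * tc y.

Lemma norm_R3 (x : R3) : norm x = sqrt (dot x x).
Proof.
destruct x as [[a b] c].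
change (norm _) with
  (sqrt (sqrt (Rabs a ^ 2 + Rabs b ^ 2) ^ 2 + Rabs c ^ 2)).
rewrite pow2_sqrt.
2:{ apply Rplus_le_le_0_compat; apply pow2_ge_0. }
rewrite 3!pow2_abs; apply f_equal.
unfold dot, zc, tc, Re, Im; cbn; ring.
Qed.

(** The orientation of a line is recorded by its unit direction vector. *)
Record oriented_line := OrientedLine {
  line_dir : R3;
  line_pt : R3 -> Prop;
  line_dir_unit : norm line_dir = 1;
  line_ptP : exists q : R3, forall x : R3,
    line_pt x <-> exists r : R, x = plus q (scal r line_dir)
}.

(** The tangent space at [p] is the plane of vectors orthogonal to [p]. *)
Record TS2 := mkTS2 {
  base : R3;
  vec : R3;
  base_unit : norm base = 1;
  vec_tangent : dot base vec = 0
}.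

Lemma Phi_line (X : TS2) : exists q : R3, forall x : R3,
  (exists r : R, x = plus (vec X) (scal r (base X))) <->
  exists r : R, x = plus q (scal r (base X)).
Proof. now exists (vec X). Qed.

Definition Phi (X : TS2) : oriented_line :=
  OrientedLine (base X)
    (fun x : R3 => exists r : R, x = plus (vec X) (scal r (base X)))
    (base_unit X) (Phi_line X).

Definition south_stereo (x : R3) : C := (zc x / RtoC (1 + tc x))%C.

(** The point of the unit sphere with stereographic coordinate [xi], where
    [Cmod xi ^ 2] is [xi * Cconj xi] as a real number. *)
Definition sphere_pt (xi : C) : R3 :=
  mkR3 (2 * xi / (1 + xi * Cconj xi))%C
       ((1 - Cmod xi ^ 2) / (1 + Cmod xi ^ 2)).

(** Partial derivatives, coordinate by coordinate, of a map defined on the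
    plane of [xi = u + i v]. *)
Definition partial_u (f : C -> R3) (xi : C) : R3 :=
  let D (g : R3 -> R) := Derive (fun u : R => g (f (u, Im xi))) (Re xi) in
  mkR3 (D (fun x => Re (zc x)), D (fun x => Im (zc x))) (D tc).

Definition partial_v (f : C -> R3) (xi : C) : R3 :=
  let D (g : R3 -> R) := Derive (fun v : R => g (f (Re xi, v))) (Im xi) in
  mkR3 (D (fun x => Re (zc x)), D (fun x => Im (zc x))) (D tc).

(** The vector [eta d/dxi + conj eta d/dconj xi], that is
    [Re eta d/du + Im eta d/dv], regarded as a vector of the ambient space
    through the parametrization [sphere_pt]. *)
Definition tangent_vec (xi eta : C) : R3 :=
  plus (scal (Re eta) (partial_u sphere_pt xi))
       (scal (Im eta) (partial_v sphere_pt xi)).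

Lemma sphere_den (a b : R) : 1 + (a * a + b * b) <> 0.
Proof. nra. Qed.

Lemma sphere_ptE (a b : R) : sphere_pt (a, b) =
  mkR3 (2 * a / (1 + (a * a + b * b)), 2 * b / (1 + (a * a + b * b)))
       ((1 - (a * a + b * b)) / (1 + (a * a + b * b))).
Proof.
unfold sphere_pt, mkR3.
assert (H : Cmod (a, b) ^ 2 = a * a + b * b).
{ unfold Cmod; rewrite pow2_sqrt; cbn; nra. }
rewrite H; apply f_equal2; [|reflexivity].
assert (E : (1 + (a, b) * Cconj (a, b))%C = RtoC (1 + (a * a + b * b))).
{ unfold Cconj, Cplus, Cmult, RtoC; cbn; apply f_equal2; ring. }
rewrite E.
unfold Cdiv; rewrite <- RtoC_inv; [|apply sphere_den].
unfold Cmult, RtoC; cbn; apply f_equal2; field; apply sphere_den.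
Qed.

Lemma sphere_pt_unit (xi : C) : norm (sphere_pt xi) = 1.
Proof.
destruct xi as [a b].
rewrite norm_R3, sphere_ptE.
refine (eq_trans _ sqrt_1); apply f_equal.
unfold dot, zc, tc, Re, Im, mkR3; cbn.
field; apply sphere_den.
Qed.

Lemma sphere_pt_stereo (xi : C) : south_stereo (sphere_pt xi) = xi.
Proof.
destruct xi as [a b].
assert (H := sphere_den a b).
unfold south_stereo; rewrite sphere_ptE; unfold mkR3, zc, tc; cbn.
replace (1 + (1 - (a * a + b * b)) / (1 + (a * a + b * b)))
  with (2 / (1 + (a * a + b * b))) by (field; exact H).
unfold Cdiv; rewrite <- RtoC_inv.
2:{ apply Rmult_integral_contrapositive_currified; [lra|].
    now apply Rinv_neq_0_compat. }
unfold Cmult, RtoC; cbn; apply f_equal2; field; exact H.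
Qed.

Lemma partial_u_tangent (xi : C) :
  dot (sphere_pt xi) (partial_u sphere_pt xi) = 0.
Proof.
destruct xi as [a b].
assert (H := sphere_den a b).
unfold partial_u; cbv zeta; change (Re (a, b)) with a; change (Im (a, b)) with b; rewrite sphere_ptE.
rewrite (Derive_ext (fun u => Re (zc (sphere_pt (u, b))))
   (fun u => 2 * u / (1 + (u * u + b * b))))
  by (intro u; now rewrite sphere_ptE).
rewrite (Derive_ext (fun u => Im (zc (sphere_pt (u, b))))
   (fun u => 2 * b / (1 + (u * u + b * b))))
  by (intro u; now rewrite sphere_ptE).
rewrite (Derive_ext (fun u => tc (sphere_pt (u, b)))
  
  (fun u => (1 - (u * u + b * b)) / (1 + (u * u + b * b))))
  by (intro u; now rewrite sphere_ptE).
unfold dot, zc, tc, mkR3; cbn.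
erewrite 3!is_derive_unique; cycle 1.
1-3: auto_derive; [exact H | reflexivity].
field; exact H.
Qed.

Lemma partial_v_tangent (xi : C) :
  dot (sphere_pt xi) (partial_v sphere_pt xi) = 0.
Proof.
destruct xi as [a b].
assert (H := sphere_den a b).
unfold partial_v; cbv zeta; change (Re (a, b)) with a; change (Im (a, b)) with b; rewrite sphere_ptE.
rewrite (Derive_ext (fun v => Re (zc (sphere_pt (a, v))))
   (fun v => 2 * a / (1 + (a * a + v * v))))
  by (intro v; now rewrite sphere_ptE).
rewrite (Derive_ext (fun v => Im (zc (sphere_pt (a, v))))
   (fun v => 2 * v / (1 + (a * a + v * v))))
  by (intro v; now rewrite sphere_ptE).
rewrite (Derive_ext (fun v => tc (sphere_pt (a, v)))
  
  (fun v => (1 - (a * a + v * v)) / (1 + (a * a + v * v))))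
  by (intro v; now rewrite sphere_ptE).
unfold dot, zc, tc, mkR3; cbn.
erewrite 3!is_derive_unique; cycle 1.
1-3: auto_derive; [exact H | reflexivity].
field; exact H.
Qed.

Lemma tangent_vec_tangent (xi eta : C) :
  dot (sphere_pt xi) (tangent_vec xi eta) = 0.
Proof.
assert (D : forall (p x y : R3) (r s : R),
  dot p (plus (scal r x) (scal s y)) = r * dot p x + s * dot p y).
{ intros [[p1 p2] p3] [[x1 x2] x3] [[y1 y2] y3] r s.
  unfold dot, zc, tc, Re, Im; cbn.
  unfold scal; cbn; unfold mult; cbn; unfold plus; cbn; ring. }
unfold tangent_vec; rewrite D, partial_u_tangent, partial_v_tangent; ring.
Qed.

Definition TS2_coord (xi eta : C) : TS2 :=
  mkTS2 (sphere_pt xi) (tangent_vec xi eta)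
    (sphere_pt_unit xi) (tangent_vec_tangent xi eta).

(** [gamma] is an affine parametrization of [L] whose parameter increases in
    the direction of the orientation of [L]. *)
Definition oriented_affine_param (L : oriented_line) (gamma : R -> R3) : Prop :=
  (forall x : R3, line_pt L x <-> exists r : R, x = gamma r) /\
  exists c : R, 0 < c /\
    forall r : R, gamma r = plus (gamma 0) (scal (r * c) (line_dir L)).

Definition closest_to_origin (L : oriented_line) (q : R3) : Prop :=
  line_pt L q /\ forall x : R3, line_pt L x -> x <> q -> norm q < norm x.

(* Main.v *)
Require Import Defs.
From Stdlib Require Import Reals Lra.
From Coquelicot Require Import Coquelicot.
Open Scope R_scope.

(** The derivative of the inverse stereographic projection in the direction
    [eta] has components [2 (eta - conj eta xi^2) / (1 + |xi|^2)^2] and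
    [-2 (eta conj xi + conj eta xi) / (1 + |xi|^2)^2], so the formulas are those
    of [r |-> vec + r base].  As [vec] is orthogonal to the unit vector [base],
    the squared distance to the origin is [|vec|^2 + r^2], minimal only at
    [r = 0]. *)

Lemma R3_plus_scal (x y : R3) (r : R) :
  plus x (scal r y) =
  mkR3 (Re (zc x) + r * Re (zc y), Im (zc x) + r * Im (zc y)) (tc x + r * tc y).
Proof. now destruct x as [[x1 x2] x3], y as [[y1 y2] y3]. Qed.

Lemma partial_u_sphere_pt (a b : R) :
  partial_u sphere_pt (a, b) =
  mkR3 (2 * (1 - a * a + b * b) / (1 + (a * a + b * b)) ^ 2,
        - 4 * a * b / (1 + (a * a + b * b)) ^ 2)
       (- 4 * a / (1 + (a * a + b * b)) ^ 2).
Proof.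
assert (H := sphere_den a b).
unfold partial_u; cbv zeta; change (Re (a, b)) with a; change (Im (a, b)) with b.
(* Each component becomes an explicit rational function of [u], which [auto_derive] can
   differentiate; its side condition at [u = a] is the nonzero denominator [H]. *)
rewrite (Derive_ext (fun u => Re (zc (sphere_pt (u, b))))
   (fun u => 2 * u / (1 + (u * u + b * b))))
  by (intro u; now rewrite sphere_ptE).
rewrite (Derive_ext (fun u => Im (zc (sphere_pt (u, b))))
   (fun u => 2 * b / (1 + (u * u + b * b))))
  by (intro u; now rewrite sphere_ptE).
rewrite (Derive_ext (fun u => tc (sphere_pt (u, b)))
  (fun u => (1 - (u * u + b * b)) / (1 + (u * u + b * b))))
  by (intro u; now rewrite sphere_ptE).
apply f_equal2; [apply f_equal2|];
  apply is_derive_unique; auto_derive; trivial; field; exact H.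
Qed.

Lemma partial_v_sphere_pt (a b : R) :
  partial_v sphere_pt (a, b) =
  mkR3 (- 4 * a * b / (1 + (a * a + b * b)) ^ 2,
        2 * (1 + a * a - b * b) / (1 + (a * a + b * b)) ^ 2)
       (- 4 * b / (1 + (a * a + b * b)) ^ 2).
Proof.
assert (H := sphere_den a b).
unfold partial_v; cbv zeta; change (Re (a, b)) with a; change (Im (a, b)) with b.
rewrite (Derive_ext (fun v => Re (zc (sphere_pt (a, v))))
   (fun v => 2 * a / (1 + (a * a + v * v))))
  by (intro v; now rewrite sphere_ptE).
rewrite (Derive_ext (fun v => Im (zc (sphere_pt (a, v))))
   (fun v => 2 * v / (1 + (a * a + v * v))))
  by (intro v; now rewrite sphere_ptE).
rewrite (Derive_ext (fun v => tc (sphere_pt (a, v)))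
  (fun v => (1 - (a * a + v * v)) / (1 + (a * a + v * v))))
  by (intro v; now rewrite sphere_ptE).
apply f_equal2; [apply f_equal2|];
  apply is_derive_unique; auto_derive; trivial; field; exact H.
Qed.

(** With xi = a + ib and eta = c + id, the numerators are the real and imaginary parts of 2 (eta -
    conj eta xi^2), and -2 (eta conj xi + conj eta xi), since eta conj xi + conj eta xi = 2 (ac +
    bd). *)
Lemma tangent_vecE (a b c d : R) :
  tangent_vec (a, b) (c, d) =
  mkR3 (2 * (c - (c * (a * a - b * b) + 2 * a * b * d))
          / (1 + (a * a + b * b)) ^ 2,
        2 * (d - (2 * a * b * c - d * (a * a - b * b)))
          / (1 + (a * a + b * b)) ^ 2)
       (- 4 * (a * c + b * d) / (1 + (a * a + b * b)) ^ 2).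
Proof.
assert (H := sphere_den a b).
unfold tangent_vec; rewrite partial_u_sphere_pt, partial_v_sphere_pt.
rewrite R3_plus_scal.
apply f_equal2; [apply f_equal2|];
  unfold zc, tc, mkR3, Re, Im, scal; cbn;
  unfold scal, mult; cbn; unfold mult; cbn; field; exact H.
Qed.

(** Makes the complex denominators real, so that division acts on each component and the identities
    below reduce to [field] over the reals. *)
Lemma Cmult_conj_succ (a b : R) :
  (1 + (a, b) * Cconj (a, b))%C = RtoC (1 + (a * a + b * b)).
Proof. unfold Cconj, Cplus, Cmult, RtoC; cbn; apply f_equal2; ring. Qed.

Lemma line_param_zc (xi eta : C) (r : R) :
  zc (plus (tangent_vec xi eta) (scal r (sphere_pt xi))) =
  ((2 * (eta - Cconj eta * xi ^ 2) + 2 * xi * (1 + xi * Cconj xi) * RtoC r)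
     / (1 + xi * Cconj xi) ^ 2)%C.
Proof.
destruct xi as [a b], eta as [c d].
assert (H := sphere_den a b).
rewrite R3_plus_scal, tangent_vecE, sphere_ptE.
rewrite Cmult_conj_succ, <- RtoC_pow.
unfold Cdiv; rewrite <- RtoC_inv by now apply pow_nonzero.
unfold zc, tc, mkR3, Re, Im, Cminus, Cplus, Copp, Cmult, Cconj, RtoC; cbn.
apply f_equal2; field; exact H.
Qed.

(** The coefficient of r comes from putting the height of the base point over the squared
    denominator: (1 - |xi|^2) (1 + |xi|^2) = 1 - xi^2 conj xi^2. *)
Lemma line_param_tc (xi eta : C) (r : R) :
  RtoC (tc (plus (tangent_vec xi eta) (scal r (sphere_pt xi)))) =
  ((- (2) * (eta * Cconj xi + Cconj eta * xi)
      + (1 - xi ^ 2 * Cconj xi ^ 2) * RtoC r)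
     / (1 + xi * Cconj xi) ^ 2)%C.
Proof.
destruct xi as [a b], eta as [c d].
assert (H := sphere_den a b).
rewrite R3_plus_scal, tangent_vecE, sphere_ptE.
rewrite Cmult_conj_succ, <- RtoC_pow.
unfold Cdiv; rewrite <- RtoC_inv by now apply pow_nonzero.
unfold zc, tc, mkR3, Re, Im, Cminus, Cplus, Copp, Cmult, Cconj, RtoC; cbn.
(* The second component says that the right-hand side has zero imaginary part. *)
apply f_equal2; field; exact H.
Qed.

Lemma R3_plus_scal_0 (v p : R3) : plus v (scal 0 p) = v.
Proof.
exact (eq_trans (f_equal (plus v) (scal_zero_l p)) (plus_zero_r v)).
Qed.

Lemma dot_plus_scal (p v : R3) (r : R) :
  dot (plus v (scal r p)) (plus v (scal r p)) =
  dot v v + 2 * r * dot p v + r ^ 2 * dot p p.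
Proof.
rewrite R3_plus_scal; unfold dot, zc, tc, mkR3, Re, Im; cbn; ring.
Qed.

Lemma dot_self_ge0 (x : R3) : 0 <= dot x x.
Proof. unfold dot; nra. Qed.

Lemma dot_self_unit (x : R3) : norm x = 1 -> dot x x = 1.
Proof.
rewrite norm_R3; intro H.
rewrite <- (sqrt_sqrt _ (dot_self_ge0 x)), H; ring.
Qed.

Lemma Phi_oriented_affine_param (X : TS2) :
  oriented_affine_param (Phi X) (fun r => plus (vec X) (scal r (base X))).
Proof.
split; [now intro x|].
(* The velocity is [base X], which is the direction of [Phi X] itself, so the positive factor is
   1. *)
exists 1; split; [lra|]; intro r; cbn [Phi line_dir].
now rewrite R3_plus_scal_0, Rmult_1_r.
Qed.

Lemma Phi_closest_to_origin (X : TS2) : closest_to_origin (Phi X) (vec X).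
Proof.
assert (E := R3_plus_scal_0 (vec X) (base X)).
split; [now exists 0|].
intros x [r ->] Hr.
rewrite 2!norm_R3; apply sqrt_lt_1_alt; split; [apply dot_self_ge0|].
rewrite dot_plus_scal, vec_tangent, (dot_self_unit _ (base_unit X)).
(* By [E], the parameter 0 would give [vec X], the point excluded by [Hr]. *)
assert (Hr0 : r <> 0) by (intros ->; exact (Hr E)).
assert (0 < r ^ 2) by now apply pow2_gt_0.
lra.
Qed.

Theorem theorem1 (xi eta : C) :
  exists gamma : R -> R3,
    (forall r : R,
       zc (gamma r) =
         ((2 * (eta - Cconj eta * xi ^ 2) + 2 * xi * (1 + xi * Cconj xi) * RtoC r)
            / (1 + xi * Cconj xi) ^ 2)%C /\
       RtoC (tc (gamma r)) =
         ((- (2) * (eta * Cconj xi + Cconj eta * xi)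
             + (1 - xi ^ 2 * Cconj xi ^ 2) * RtoC r)
            / (1 + xi * Cconj xi) ^ 2)%C) /\
    oriented_affine_param (Phi (TS2_coord xi eta)) gamma /\
    closest_to_origin (Phi (TS2_coord xi eta)) (gamma 0).
Proof.
(* This is the parametrization by which [Phi] defines the line. *)
exists (fun r => plus (tangent_vec xi eta) (scal r (sphere_pt xi))).
split; [|split].
- intro r; split; [apply line_param_zc | apply line_param_tc].
- apply (Phi_oriented_affine_param (TS2_coord xi eta)).
- rewrite R3_plus_scal_0.
  apply (Phi_closest_to_origin (TS2_coord xi eta)).
Qed.
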